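(* Let $k$ be a field of characteristic $2$ and let $$P=x+x^2y,\qquad Q=y+xz+x^2yz,\qquad R=z+x^2z^2 .$$ For every $n\geq 3$, the map $$F_n=(P,Q,R,x_4,\dots,x_n)\colon\mathbb{A}_k^n\longrightarrow\mathbb{A}_k^n,$$ where $\mathbb{A}_k^n$ has coordinates $x,y,z,x_4,\dots,x_n$, is a counterexample to the separable Jacobian conjecture in characteristic $2$.
   Context: The separable Jacobian conjecture (in characteristic $p>0$) is the following assertion. Let $k$ be a field of characteristic $p>0$, let $X=(x_1,\dots,x_n)$, and let $F=(F_1,\dots,F_n)\in k[X]^n$. Write $k(F)=k(F_1,\dots,F_n)\subseteq k(X)=k(x_1,\dots,x_n)$, and let $\operatorname{Jac}(F)$ be the matrix of formal partial derivatives of $F$. Assume that $\det\operatorname{Jac}(F)\in k^\times$ and $p\nmid [k(X):k(F)]$. Then $F$ is a polynomial automorphism of $\mathbb{A}_k^n$ (i.e. it has a two-sided inverse given by polynomials over $k$). A map is a counterexample to the conjecture in characteristic $2$ if it satisfies both hypotheses with $p=2$ (determinant of the Jacobian matrix in $k^\times$, and field extension degree finite and not divisible by $2$) but is not a polynomial automorphism of $\mathbb{A}_k^n$. *)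

(* Defs.v *)
From mathcomp Require Import all_boot all_order all_algebra.
From mathcomp Require Export mpoly.

Set Implicit Arguments.
Unset Strict Implicit.
Unset Printing Implicit Defensive.

Import GRing.Theory.
Local Open Scope ring_scope.

(* The smallest subfield of [K] containing [A]; since [0^-1 = 0] in MathComp,
   closure under division needs no side condition. *)
Inductive generated_subfield (K : fieldType) (A : K -> Prop) : K -> Prop :=
  | GenSubfieldBase x : A x -> generated_subfield A x
  | GenSubfieldOne : generated_subfield A 1
  | GenSubfieldSub x y :
      generated_subfield A x -> generated_subfield A y ->
      generated_subfield A (x - y)
  | GenSubfieldDiv x y :
      generated_subfield A x -> generated_subfield A y ->
      generated_subfield A (x / y).

(* [K : L] is finite and equal to [d]: [K] has an [L]-basis with [d] elements.
   [L] is meant to be a subfield of [K]. *)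
Definition extension_degree (K : fieldType) (L : K -> Prop) (d : nat) : Prop :=
  exists b : 'I_d -> K,
    (forall c : 'I_d -> K, (forall i, L (c i)) ->
       \sum_(i < d) c i * b i = 0 -> forall i, c i = 0) /\
    (forall z : K, exists2 c : 'I_d -> K,
       (forall i, L (c i)) & z = \sum_(i < d) c i * b i).

Section PolynomialMaps.
Variables (k : fieldType) (n : nat).
Implicit Types F G : n.-tuple {mpoly k[n]}.

Definition jacobian F : 'M[{mpoly k[n]}]_n :=
  \matrix_(i, j) mderiv j (tnth F i).

(* k(F) inside k(X) = {fraction {mpoly k[n]}} *)
Definition map_subfield F : {fraction {mpoly k[n]}} -> Prop :=
  generated_subfield (fun f : {fraction {mpoly k[n]}} =>
    (exists c : k, f = tofrac c%:MP_[n]) \/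
    (exists i : 'I_n, f = tofrac (tnth F i))).

Definition polynomial_automorphism F : Prop :=
  exists G, (forall i, tnth F i \mPo G = 'X_i) /\
            (forall i, tnth G i \mPo F = 'X_i).

Definition separable_jacobian_hypotheses (p : nat) F : Prop :=
  [/\ p \in [pchar k],
      (exists2 c : k, c != 0 & \det (jacobian F) = c%:MP_[n])
    & (exists2 d : nat, extension_degree (map_subfield F) d & ~~ (p %| d)%N)].

Definition separable_jacobian_counterexample (p : nat) F : Prop :=
  separable_jacobian_hypotheses p F /\ ~ polynomial_automorphism F.

End PolynomialMaps.

Definition separable_jacobian_conjecture (p : nat) : Prop :=
  forall (k : fieldType) (n : nat) (F : n.-tuple {mpoly k[n]}),
    separable_jacobian_hypotheses p F -> polynomial_automorphism F.

(* The coordinates x, y, z, x_4, ..., x_n are 'X_0, 'X_1, 'X_2, ..., 'X_(n-1). *)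
Definition Fmap (k : fieldType) (n : nat) (hn : (3 <= n)%N) :
    n.-tuple {mpoly k[n]} :=
  let x : {mpoly k[n]} := 'X_(Ordinal (leq_trans (isT : 0 < 3)%N hn)) in
  let y : {mpoly k[n]} := 'X_(Ordinal (leq_trans (isT : 1 < 3)%N hn)) in
  let z : {mpoly k[n]} := 'X_(Ordinal (leq_trans (isT : 2 < 3)%N hn)) in
  [tuple match val i with
         | 0 => x + x ^+ 2 * y
         | 1 => y + x * z + x ^+ 2 * y * z
         | 2 => z + x ^+ 2 * z ^+ 2
         | _ => 'X_i
         end | i < n].

(* Main.v *)
Require Import Defs.
From mathcomp Require Import all_boot all_order all_algebra.
From mathcomp Require Import ring zify fraction generic_quotient.

Set Implicit Arguments.
Unset Strict Implicit.
Unset Printing Implicit Defensive.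

Import Order.TTheory GRing.Theory.
Local Open Scope ring_scope.

(** Write P, Q, R for the first three coordinates of the map, and let k(F) be the
field that they generate together with the remaining variables.

The Jacobian determinant.  In characteristic 2 the squares have derivative 0, so
the rows of the Jacobian matrix are (1, x^2, 0), (z, 1 + x^2 z, P), (0, 0, 1) and
then those of the identity.  This is a lower unitriangular matrix times an upper
unitriangular one (lemma [det_jacobian]).

Failure of injectivity.  The points (1, 1, 0) and (0, 1, 0) have the same image,
which a map with a polynomial inverse excludes (lemma [not_automorphism]).

The degree is 3.  Put T = 1 + xy + x^2 Q^2.  Then P = xT - x^3 Q^2, while
characteristic 2 gives T = 1 + PQ + P^2 R.  Hence k(F) is generated by P, Q, T and
the remaining variables, and x is a root of the cubic Q^2 X^3 - T X + P over k(F).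
Moreover x generates k(X) over k(F): one reads y = (T - 1)/x - x Q^2 off the
definition of T, and z = (Q - y)/P because Q = y + Pz.  So k(X) has degree at most
3 over k(F), and it remains to see that 1, x, x^2 are linearly independent
(lemma [xpowers_free]).  Now x, Q, T are algebraically independent
(lemma [x_Q_T_injective]), and in these coordinates P is a polynomial of degree 3
in x over k[Q, T].  A polynomial in P, Q, T then has a leading monomial whose
exponent in x is divisible by 3, so multiplication by 1, x and x^2 gives leading
monomials that cannot cancel. *)

(** * Extensions generated by a root of a cubic *)

Section CubicExtension.
Variables (K : fieldType) (A : K -> Prop).
Notation L := (generated_subfield A).

Lemma subfield0 : L 0.
Proof. by rewrite -(subrr 1); apply: GenSubfieldSub; apply: GenSubfieldOne. Qed.

Lemma subfieldN u : L u -> L (- u).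
Proof. by move=> Lu; rewrite -sub0r; apply: GenSubfieldSub => //; apply: subfield0. Qed.

Lemma subfieldD u v : L u -> L v -> L (u + v).
Proof.
by move=> Lu Lv; rewrite -[v]opprK; apply: GenSubfieldSub => //; apply: subfieldN.
Qed.

Lemma subfieldV u : L u -> L u^-1.
Proof. by rewrite -div1r; apply: GenSubfieldDiv; apply: GenSubfieldOne. Qed.

Lemma subfieldM u v : L u -> L v -> L (u * v).
Proof.
by move=> Lu Lv; rewrite -[v]invrK; apply: GenSubfieldDiv => //; apply: subfieldV.
Qed.

Variables (x s t : K).
Hypotheses (Ls : L s) (Lt : L t) (xE : x ^+ 3 = t * x + s).
Hypothesis free : forall a b c, L a -> L b -> L c -> a + b * x + c * x ^+ 2 = 0 ->
  [/\ a = 0, b = 0 & c = 0].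

(** The elements of L[x].  The lemmas below show that it is a field; this is what
reduces the claim that x generates K to expressing generators of K. *)
Definition quadratic_span (u : K) : Prop :=
  exists a b c, [/\ L a, L b, L c & u = a + b * x + c * x ^+ 2].

Local Ltac in_L := repeat first [assumption | apply: subfieldD
  | apply: subfieldM | apply: subfieldN | apply: subfieldV | apply: subfield0
  | apply: GenSubfieldOne ].

Lemma span_L a : L a -> quadratic_span a.
Proof. by move=> La; exists a, 0, 0; split; in_L; ring. Qed.

Lemma span_x : quadratic_span x.
Proof. by exists 0, 1, 0; split; in_L; ring. Qed.

Lemma spanD u v : quadratic_span u -> quadratic_span v -> quadratic_span (u + v).
Proof.
move=> [a [b [c [La Lb Lc ->]]]] [a' [b' [c' [La' Lb' Lc' ->]]]].
by exists (a + a'), (b + b'), (c + c'); split; in_L; ring.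
Qed.

Lemma spanM u v : quadratic_span u -> quadratic_span v -> quadratic_span (u * v).
Proof.
move=> [a [b [c [La Lb Lc ->]]]] [a' [b' [c' [La' Lb' Lc' ->]]]].
exists (a * a' + (b * c' + c * b') * s),
  (a * b' + b * a' + (b * c' + c * b') * t + c * c' * s),
  (a * c' + b * b' + c * a' + c * c' * t); split; in_L.
have -> : (a + b * x + c * x ^+ 2) * (a' + b' * x + c' * x ^+ 2) =
  a * a' + (a * b' + b * a') * x + (a * c' + b * b' + c * a') * x ^+ 2
  + (b * c' + c * b') * x ^+ 3 + c * c' * (x * x ^+ 3) by ring.
by rewrite xE; ring.
Qed.

Lemma spanN u : quadratic_span u -> quadratic_span (- u).
Proof.
by move=> hu; rewrite -mulN1r; apply: spanM => //; apply: span_L; in_L.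
Qed.

Lemma spanX u m : quadratic_span u -> quadratic_span (u ^+ m).
Proof.
move=> hu; elim: m => [|m IH]; first by apply: span_L; in_L.
by rewrite exprS; apply: spanM.
Qed.

(** Dividing the minimal cubic of x by X + d leaves a constant remainder r, so that
(x + d) q(x) = r with q quadratic; r does not vanish because neither factor does,
by linear independence. *)
Lemma span_linear_inv a b : L a -> L b -> quadratic_span (a + b * x)^-1.
Proof.
move=> La Lb; have [->|b0] := eqVneq b 0.
  by rewrite mul0r addr0; apply: span_L; in_L.
pose d := a / b; have Ld : L d by rewrite /d; in_L.
have -> : (a + b * x)^-1 = b^-1 * (d + x)^-1.
  by rewrite -invfM; congr (_^-1); rewrite /d; field.
apply: spanM; first by apply: span_L; in_L.
pose q := (d ^+ 2 - t) + (- d) * x + 1 * x ^+ 2.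
pose r := s - d * t + d ^+ 3.
have Lr : L r by rewrite /r; in_L.
have Sq : quadratic_span q by exists (d ^+ 2 - t), (- d), 1; split=> //; in_L.
have e : (d + x) * q = r.
  have -> : (d + x) * q = x ^+ 3 + (d ^+ 3 - d * t - t * x) by rewrite /q; ring.
  by rewrite xE /r; ring.
have q0 : q != 0.
  apply/eqP => q0; have [||| _ _ /eqP] := free _ _ _ q0; try by in_L.
  by rewrite oner_eq0.
have dx0 : d + x != 0.
  apply/eqP => z; have [|||| _ /eqP] := @free d 1 0; try by in_L.
    by rewrite -[RHS]z; ring.
  by rewrite oner_eq0.
have r0 : r != 0 by rewrite -e mulf_neq0.
have -> : (d + x)^-1 = r^-1 * q.
  by rewrite -e invfM mulfVK.
by apply: spanM => //; apply: span_L; in_L.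
Qed.

(** The same Euclidean step for a monic quadratic: dividing the minimal cubic by it
leaves a linear remainder, whose inverse is known. *)
Lemma spanV u : quadratic_span u -> quadratic_span u^-1.
Proof.
move=> [a [b [c [La Lb Lc ->]]]].
have [->|c0] := eqVneq c 0.
  by rewrite mul0r addr0; apply: span_linear_inv.
pose f := b / c; pose g := a / c.
have Lf : L f by rewrite /f; in_L.
have Lg : L g by rewrite /g; in_L.
have -> : (a + b * x + c * x ^+ 2)^-1 = c^-1 * (g + f * x + x ^+ 2)^-1.
  by rewrite -invfM; congr (_^-1); rewrite /f /g; field.
apply: spanM; first by apply: span_L; in_L.
have e : (g + f * x + x ^+ 2) * (x - f) = s - g * f + (t - f ^+ 2 + g) * x.
  have -> : (g + f * x + x ^+ 2) * (x - f) = x ^+ 3 + (g - f ^+ 2) * x - g * f by ring.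
  by rewrite xE; ring.
have nz v w : L v -> L w -> v + w * x + x ^+ 2 != 0.
  move=> Lv Lw; apply/eqP => z; have [|||| _ _ /eqP] := @free v w 1; try by in_L.
    by rewrite -[RHS]z; ring.
  by rewrite oner_eq0.
have xf0 : x - f != 0.
  apply/eqP => z; have [|||| _ /eqP] := @free (- f) 1 0; try by in_L.
    by rewrite -[RHS]z; ring.
  by rewrite oner_eq0.
have -> : (g + f * x + x ^+ 2)^-1 = (x - f) * (s - g * f + (t - f ^+ 2 + g) * x)^-1.
  by rewrite -e invfM [RHS]mulrC mulfVK.
apply: spanM.
  by apply: spanD; [exact: span_x | apply: span_L; in_L].
by apply: span_linear_inv; in_L.
Qed.

Lemma cubic_extension_degree :
  (forall u, quadratic_span u) -> extension_degree L 3.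
Proof.
move=> span; exists (fun i : 'I_3 => x ^+ i); split=> [c Lc|z].
  rewrite !big_ord_recl big_ord0 /= => e.
  have [|c0 c1 c2] := free (Lc ord0) (Lc (lift ord0 ord0))
     (Lc (lift ord0 (lift ord0 ord0))).
    by rewrite -[RHS]e /bump /=; ring.
  move=> [[|[|[|]]] hi] //; [rewrite -[RHS]c0|rewrite -[RHS]c1|rewrite -[RHS]c2];
  by congr c; apply: val_inj.
have [a [b [c [La Lb Lc ->]]]] := span z.
exists (fun i : 'I_3 => match val i with 0 => a | 1 => b | _ => c end).
  by move=> [[|[|]] hi].
by rewrite !big_ord_recl big_ord0 /= /bump /=; ring.
Qed.

End CubicExtension.

(** * Identities in fraction fields *)

(* The identities are stated for arbitrary elements, so that named polynomials are
   substituted in them without being expanded into sums of monomials. *)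

Lemma sub_fractions (K : fieldType) (x x' y y' : K) : y != 0 -> y' != 0 ->
  x / y - x' / y' = (x * y' - x' * y) / (y * y').
Proof. by move=> y0 y0'; field; rewrite y0 y0'. Qed.

Lemma mulf3_eq0_left (A : idomainType) (a b c : A) :
  b != 0 -> c != 0 -> a * b * c = 0 -> a = 0.
Proof.
move=> b0 c0 /eqP; rewrite mulf_eq0 (negPf c0) orbF mulf_eq0 (negPf b0) orbF.
by move/eqP.
Qed.

Lemma clear_denominators (K : fieldType) (x a a' b b' c c' : K) :
  a' != 0 -> b' != 0 -> c' != 0 ->
  a / a' + b / b' * x + c / c' * x ^+ 2 = 0 ->
  a * b' * c' + b * a' * c' * x + c * a' * b' * x ^+ 2 = 0.
Proof.
move=> a0 b0 c0 e; rewrite -[RHS](mulr0 (a' * b' * c')) -e.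
by field; rewrite a0 b0 c0.
Qed.

Lemma solve_cubic (K : fieldType) (x P Q T : K) : Q != 0 ->
  P = x * T - x ^+ 3 * Q ^+ 2 -> x ^+ 3 = T / Q ^+ 2 * x + - (P / Q ^+ 2).
Proof. by move=> Q0 ->; field. Qed.

Lemma solve_y (K : fieldType) (x y Q T : K) : x != 0 ->
  T = 1 + x * y + x ^+ 2 * Q ^+ 2 -> y = (T - 1) * x^-1 - x * Q ^+ 2.
Proof. by move=> x0 ->; field. Qed.

Section Tofrac.
Variables (A : idomainType) (x y z : A).

Lemma tofrac_T : tofrac (1 + x * y + x ^+ 2 * z ^+ 2) =
  1 + tofrac x * tofrac y + tofrac x ^+ 2 * tofrac z ^+ 2.
Proof. by rewrite !(tofracD, tofracXn, tofracM, tofrac1). Qed.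

Lemma tofrac_PQR : tofrac (1 + x * y + x ^+ 2 * z) =
  1 + tofrac x * tofrac y + tofrac x ^+ 2 * tofrac z.
Proof. by rewrite !(tofracD, tofracXn, tofracM, tofrac1). Qed.

Lemma tofrac_P : tofrac (x * y - x ^+ 3 * z ^+ 2) =
  tofrac x * tofrac y - tofrac x ^+ 3 * tofrac z ^+ 2.
Proof. by rewrite !(tofracB, tofracXn, tofracM). Qed.

End Tofrac.

Section FractionQuotient.
Local Open Scope quotient_scope.

Lemma frac_quotient (A : idomainType) (u : {fraction A}) :
  exists a b, b != 0 /\ u = tofrac a / tofrac b.
Proof.
elim/quotW: u => r; exists (frac r).1, (frac r).2.
have d0 := denom_ratioP r; split=> //.
apply: (canRL (mulfK _)); first by rewrite tofrac_eq0.
rewrite {1}/tofrac; unlock tofrac; rewrite -[LHS]FracField.pi_mul.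
apply/eqmodP => /=; rewrite FracField.equivfE /FracField.mulf /=.
by rewrite !numden_Ratio ?(oner_eq0, mulr1, mul1r) // mulrC.
Qed.

End FractionQuotient.

(** * Leading monomials of compositions *)

Section Leads.
Variables (k : fieldType) (n : nat).

(** Terms with pairwise different leading monomials cannot cancel: the largest of
these monomials survives in the sum. *)
Lemma lead_sum_distinct (I : eqType) (s : seq I) (g : I -> {mpoly k[n]}) :
    uniq s -> has (fun i => g i != 0) s ->
    {in s &, forall i j, g i != 0 -> g j != 0 ->
       mlead (g i) = mlead (g j) -> i = j} ->
  exists i, [/\ i \in s, g i != 0, \sum_(j <- s) g j != 0
              & mlead (\sum_(j <- s) g j) = mlead (g i)].
Proof.
elim: s => // a s IH /= /andP[as_ us] hs inj.
rewrite big_cons.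
have inj' : {in s &, forall i j, g i != 0 -> g j != 0 ->
       mlead (g i) = mlead (g j) -> i = j}.
  by move=> i j si sj; apply: inj; rewrite inE ?si ?sj orbT.
have [has_s|nhas] := boolP (has (fun i => g i != 0) s); last first.
  rewrite (negPf nhas) orbF in hs.
  exists a; rewrite inE eqxx big1_seq ?addr0 // => j /= sj.
  by apply/eqP/negPn; apply: (hasPn nhas).
have [i [si gi sn0 lead_s]] := IH us has_s inj'.
have [ga0|ga] := eqVneq (g a) 0.
  by exists i; rewrite inE si orbT ga0 add0r.
have neq : mlead (g a) != mlead (\sum_(j <- s) g j).
  apply: contraNneq as_; rewrite lead_s => e.
  by rewrite (inj a i) ?mem_head // inE si orbT.
have nz : g a + \sum_(j <- s) g j != 0.
  by apply: contraNneq neq => /eqP; rewrite addr_eq0 => /eqP ->; rewrite mleadN.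
have := mleadD neq.
case: (leP (mlead (g a)) (mlead (\sum_(j <- s) g j))) => _ ->.
  by exists i; rewrite inE si orbT.
by exists a; rewrite inE eqxx.
Qed.

(** The exponent of the product of the leading monomials of the [t_i ^ m_i], that is,
the leading monomial of ['X_[m] \mPo t]. *)
Definition lead_exponent (t : n.-tuple {mpoly k[n]}) (m : 'X_{1..n}) : 'X_{1..n} :=
  (\sum_(i < n) mlead (tnth t i) *+ m i)%MM.

(** When distinct monomials are sent to polynomials with distinct leading monomials,
nothing cancels in [p \mPo t].  This gives both algebraic independence of the [t_i]
and control of the leading monomials of the algebra that they generate. *)
Lemma lead_comp (t : n.-tuple {mpoly k[n]}) p :
    (forall i, tnth t i != 0) -> injective (lead_exponent t) -> p != 0 ->
  p \mPo t != 0 /\ exists m, mlead (p \mPo t) = lead_exponent t m.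
Proof.
move=> t0 inj p0.
pose g (m : 'X_{1..n}) := p@_m *: ('X_[m] \mPo t).
have leadX m : 'X_[m] \mPo t != 0 /\ mlead ('X_[m] \mPo t) = lead_exponent t m.
  rewrite comp_mpolyX; split.
    by apply/prodf_neq0 => i _; rewrite expf_neq0.
  rewrite mlead_prod => [|i _ _]; last by rewrite expf_neq0.
  by rewrite /lead_exponent; apply: eq_bigr => i _; rewrite mleadX.
have gE m : g m != 0 -> mlead (g m) = lead_exponent t m.
  rewrite /g scaler_eq0 negb_or => /andP[c0 _].
  by rewrite mleadZ // (leadX m).2.
have -> : p \mPo t = \sum_(m <- msupp p) g m.
  by rewrite comp_mpolyEX.
have [||i [_ gi ? ->]] := @lead_sum_distinct _ (msupp p) g (msupp_uniq p).
- apply/hasP; exists (mlead p); first exact: mlead_supp.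
  by rewrite /g scaler_eq0 mleadc_eq0 (negPf p0) (negPf (leadX _).1).
- by move=> i j _ _ gi gj; rewrite (gE i gi) (gE j gj) => /inj.
by split=> //; exists i; rewrite gE.
Qed.

Lemma comp_mpoly_comp (s t : n.-tuple {mpoly k[n]}) p :
  (p \mPo s) \mPo t = p \mPo [tuple tnth s i \mPo t | i < n].
Proof.
rewrite !(comp_mpolyEX p) raddf_sum /=.
apply: eq_bigr => m _; rewrite !comp_mpolyZ !comp_mpolyX rmorph_prod /=.
congr (_ *: _); apply: eq_bigr => i _.
by rewrite rmorphXn /= tnth_mktuple.
Qed.

End Leads.

(** * Polynomial maps that move three coordinates *)

Section ThreeCoordinates.
Variables (k : fieldType) (n : nat) (hn : (3 <= n)%N).

Definition ord_x : 'I_n := Ordinal (leq_trans (isT : 0 < 3)%N hn).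
Definition ord_y : 'I_n := Ordinal (leq_trans (isT : 1 < 3)%N hn).
Definition ord_z : 'I_n := Ordinal (leq_trans (isT : 2 < 3)%N hn).

(** [Fmap] is of this form, and so are the changes of coordinates used below; hence
they can all be composed and evaluated by the same lemmas. *)
Definition subst3 (a b c : {mpoly k[n]}) : n.-tuple {mpoly k[n]} :=
  [tuple match val i with 0 => a | 1 => b | 2 => c | _ => 'X_i end | i < n].

Variant index3_spec (i : 'I_n) : Prop :=
  | Index0 of i = ord_x | Index1 of i = ord_y | Index2 of i = ord_z | IndexGe of (3 <= i)%N.

Lemma index3P i : index3_spec i.
Proof.
case: i => [[|[|[|v]]] hv]; [apply: Index0|apply: Index1|apply: Index2|exact: IndexGe];
exact: val_inj.
Qed.

Lemma tnth_subst3 a b c :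
  [/\ tnth (subst3 a b c) ord_x = a, tnth (subst3 a b c) ord_y = b,
      tnth (subst3 a b c) ord_z = c
    & forall i : 'I_n, (3 <= i)%N -> tnth (subst3 a b c) i = 'X_i].
Proof.
split; rewrite ?tnth_mktuple //.
by move=> [[|[|[|v]]] hv] // _; rewrite tnth_mktuple.
Qed.

Lemma comp_mpoly_var (t : n.-tuple {mpoly k[n]}) i : 'X_i \mPo t = tnth t i.
Proof. by rewrite comp_mpolyXU -tnth_nth. Qed.

Lemma comp_subst3 a b c a' b' c' p :
  (p \mPo subst3 a b c) \mPo subst3 a' b' c' =
  p \mPo subst3 (a \mPo subst3 a' b' c') (b \mPo subst3 a' b' c') (c \mPo subst3 a' b' c').
Proof.
rewrite comp_mpoly_comp; congr (_ \mPo _); apply: eq_from_tnth => i.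
rewrite tnth_mktuple.
have [t0 t1 t2 t3] := tnth_subst3 a b c.
have [u0 u1 u2 u3] := tnth_subst3 a' b' c'.
set w := subst3 a' b' c' in u0 u1 u2 u3 *.
have [v0 v1 v2 v3] := tnth_subst3 (a \mPo w) (b \mPo w) (c \mPo w).
case: (index3P i) => [->|->|->|hi]; rewrite ?t0 ?t1 ?t2 ?v0 ?v1 ?v2 //.
by rewrite t3 // v3 // comp_mpoly_var u3.
Qed.

Lemma subst3_id p : p \mPo subst3 'X_ord_x 'X_ord_y 'X_ord_z = p.
Proof.
rewrite -[RHS]comp_mpoly_id; congr (_ \mPo _); apply: eq_from_tnth => i.
have [t0 t1 t2 t3] := tnth_subst3 'X_ord_x 'X_ord_y 'X_ord_z.
rewrite tnth_mktuple.
by case: (index3P i) => [->|->|->|hi]; rewrite ?t0 ?t1 ?t2 // t3.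
Qed.

Lemma lead_exponent_subst3 a b c m (j : 'I_n) :
  lead_exponent (subst3 a b c) m j =
  (mlead a j * m ord_x + mlead b j * m ord_y + mlead c j * m ord_z +
   (if 3 <= j then m j else 0))%N.
Proof.
have [t0 t1 t2 t3] := tnth_subst3 a b c.
rewrite /lead_exponent mnm_sumE.
under eq_bigr => i _ do rewrite mulmnE.
rewrite (bigD1 ord_x) //= (bigD1 ord_y) //= (bigD1 ord_z) //= t0 t1 t2 !addnA.
congr (_ + _)%N.
rewrite (eq_bigr (fun i : 'I_n => ((i == j) * m i)%N)); last first.
  move=> i /andP[/andP[n0 n1] n2].
  case: (index3P i) n0 n1 n2 => [->|->|->|hi]; rewrite ?eqxx //.
  by move=> _ _ _; rewrite t3 // mleadXm mnm1E.
case: ifP => hj; last first.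
  rewrite big1 // => i /andP[/andP[n0 n1] n2].
  case: (index3P i) n0 n1 n2 => [->|->|->|hi]; rewrite ?eqxx // => _ _ _.
  by case: eqP => // e; rewrite -e hi in hj.
rewrite (bigD1 j) ?eqxx ?mul1n /=; last first.
  by rewrite -!val_eqE /=; case: (nat_of_ord j) hj => [|[|[|]]].
by rewrite big1 ?addn0 // => i /andP[_ /negPf ->].
Qed.

Lemma lead_add (p q : {mpoly k[n]}) :
  (mdeg (mlead p) < mdeg (mlead q))%N -> mlead (p + q) = mlead q.
Proof. by move=> /lt_mdeg_ltmc /mleadDr. Qed.

Lemma var_neq0 (i : 'I_n) : 'X_i != 0 :> {mpoly k[n]}.
Proof. by rewrite -msupp_eq0 msuppX. Qed.

(** * Linear independence of the powers of x *)

Local Notation X0 := ('X_ord_x : {mpoly k[n]}).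
Local Notation X1 := ('X_ord_y : {mpoly k[n]}).
Local Notation X2 := ('X_ord_z : {mpoly k[n]}).

Definition coordP := X0 + X0 ^+ 2 * X1.
Local Notation P := coordP.
Definition coordQ := X1 + X0 * X2 + X0 ^+ 2 * X1 * X2.
Local Notation Q := coordQ.
Definition coordR := X2 + X0 ^+ 2 * X2 ^+ 2.
Local Notation R := coordR.

(** The auxiliary coordinate: x, Q, T generate k(x, y, z), P is a polynomial
in them, and in characteristic 2 the element T belongs to k(P, Q, R). *)
Definition coordT := 1 + X0 * X1 + X0 ^+ 2 * Q ^+ 2.
Local Notation T := coordT.

Lemma lead_coordQ : mlead Q = (U_(ord_x) *+ 2 + U_(ord_y) + U_(ord_z))%MM.
Proof.
have e : mlead (X0 ^+ 2 * X1 * X2) = (U_(ord_x) *+ 2 + U_(ord_y) + U_(ord_z))%MM.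
  by rewrite mpolyXn -!mpolyXD mleadXm.
have e' : mlead (X0 * X2) = (U_(ord_x) + U_(ord_z))%MM.
  by rewrite -mpolyXD mleadXm.
rewrite /coordQ lead_add // (lead_add (q := X0 * X2)) e' ?e ?mleadXm;
by rewrite !(mdegD, mdegMn, mdeg1).
Qed.

Lemma coordQ_neq0 : Q != 0.
Proof.
by apply/eqP => q0; have := congr1 (@mdeg n) lead_coordQ;
rewrite q0 mlead0 mdeg0 !mdegD mdeg1.
Qed.

(** The leading monomials x, x^2 y z, xy have linearly independent exponents. *)
Lemma x_Q_xy_injective p : p \mPo subst3 X0 Q (X0 * X1) = 0 -> p = 0.
Proof.
move/eqP; apply: contraTeq => p0; apply: (lead_comp _ _ p0).1 => [i|m m' /mnmP e].
  have [t0 t1 t2 t3] := tnth_subst3 X0 Q (X0 * X1).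
  case: (index3P i) => [->|->|->|hi]; rewrite ?t0 ?t1 ?t2 ?var_neq0 ?mulf_neq0 ?var_neq0 //.
    exact: coordQ_neq0.
  by rewrite t3 // var_neq0.
have e0 := e ord_x; have e1 := e ord_y; have e2 := e ord_z.
move: e0 e1 e2; rewrite !lead_exponent_subst3 lead_coordQ -mpolyXD !mleadXm.
rewrite !mnmDE ?mulmnE !mnm1E -!val_eqE /= => e0 e1 e2.
apply/mnmP => j; case: (index3P j) => [->|->|->|hj]; try lia.
move: (e j); rewrite !lead_exponent_subst3 lead_coordQ -mpolyXD !mleadXm hj.
by rewrite !mnmDE ?mulmnE !mnm1E -!val_eqE /=; case: (nat_of_ord j) hj => [|[|[|v]]].
Qed.

(** The leading monomials of x, Q, T are dependent, since T is dominated by x^2 Q^2.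
But (x, Q, T) arises from (x, Q, xy) by the triangular automorphism that adds
1 + x^2 Q^2 to the last coordinate, so independence is inherited. *)
Lemma x_Q_T_injective p : p \mPo subst3 X0 Q T = 0 -> p = 0.
Proof.
set tau := subst3 X0 X1 (1 + X2 + X0 ^+ 2 * X1 ^+ 2).
have tau_inj r : r \mPo tau = 0 -> r = 0.
  pose tau' := subst3 X0 X1 (X2 - 1 - X0 ^+ 2 * X1 ^+ 2).
  move=> e; rewrite -[r]subst3_id.
  have -> : subst3 X0 X1 X2 = subst3 (X0 \mPo tau') (X1 \mPo tau')
      ((1 + X2 + X0 ^+ 2 * X1 ^+ 2) \mPo tau').
    have [t0 t1 t2 _] := tnth_subst3 X0 X1 (X2 - 1 - X0 ^+ 2 * X1 ^+ 2).
    rewrite !(rmorphD, rmorphM, rmorphXn, rmorph1) /= !comp_mpoly_var t0 t1 t2.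
    by congr subst3; ring.
  by rewrite -comp_subst3 -/tau e rmorph0.
move=> e; apply: tau_inj; apply: x_Q_xy_injective; rewrite comp_subst3 -[RHS]e.
have [t0 t1 t2 _] := tnth_subst3 X0 Q (X0 * X1).
by rewrite !(rmorphD, rmorphM, rmorphXn, rmorph1) /= !comp_mpoly_var t0 t1 t2.
Qed.

(** Here the variables stand for x, Q, T, and the first component is the expression
of P in them. *)
Definition cubic_subst := subst3 (X0 * X2 - X0 ^+ 3 * X1 ^+ 2) X1 X2.

(** Among the leading monomials of the components, x occurs only in that of the
first one, which is x^3 Q^2. *)
Lemma lead_cubic_subst p : p \mPo cubic_subst != 0 ->
  exists d, mlead (p \mPo cubic_subst) ord_x = (3 * d)%N.
Proof.
have lead0 : mlead (X0 * X2 - X0 ^+ 3 * X1 ^+ 2) = (U_(ord_x) *+ 3 + U_(ord_y) *+ 2)%MM.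
  have e : mlead (- (X0 ^+ 3 * X1 ^+ 2)) = (U_(ord_x) *+ 3 + U_(ord_y) *+ 2)%MM.
    by rewrite mleadN !mpolyXn -mpolyXD mleadXm.
  rewrite lead_add // e -mpolyXD mleadXm.
  by rewrite !(mdegD, mdegMn, mdeg1).
move=> pt; have p0 : p != 0 by apply: contraNneq pt => ->; rewrite rmorph0.
have [|m m' /mnmP E|] := @lead_comp _ _ cubic_subst p _ _ p0.
- move=> i.
  have [t0 t1 t2 t3] := tnth_subst3 (X0 * X2 - X0 ^+ 3 * X1 ^+ 2) X1 X2.
  case: (index3P i) => [->|->|->|hi]; rewrite ?t0 ?t1 ?t2 ?var_neq0 //.
    by apply/eqP => q0; have := congr1 (@mdeg n) lead0;
    rewrite q0 mlead0 mdeg0 !mdegD !mdeg1.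
  by rewrite t3 // var_neq0.
- have := E ord_x; have := E ord_y; have := E ord_z.
  rewrite !lead_exponent_subst3 lead0 !mleadXm.
  rewrite !mnmDE ?mulmnE !mnm1E -!val_eqE /= => e2 e1 e0.
  apply/mnmP => j; case: (index3P j) => [->|->|->|hj]; try lia.
  move: (E j); rewrite !lead_exponent_subst3 lead0 !mleadXm hj.
  by rewrite !mnmDE ?mulmnE !mnm1E -!val_eqE /=; case: (nat_of_ord j) hj => [|[|[|v]]].
- move=> _ [m ->]; exists (m ord_x).
  rewrite lead_exponent_subst3 lead0 !mleadXm.
  by rewrite !mnmDE ?mulmnE !mnm1E -!val_eqE /=; lia.
Qed.

Lemma cubic_subst_free (a : 'I_3 -> {mpoly k[n]}) :
  \sum_(i < 3) (a i \mPo cubic_subst) * X0 ^+ i = 0 -> forall i, a i \mPo cubic_subst = 0.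
Proof.
pose g (i : 'I_3) := (a i \mPo cubic_subst) * X0 ^+ i.
have gE i : g i != 0 -> exists d, mlead (g i) ord_x = (3 * d + i)%N.
  rewrite /g mulf_eq0 negb_or => /andP[ai xi].
  rewrite mleadM // mleadX ?var_neq0 // mleadXm mnmDE mulmnE mnm1E eqxx mul1n.
  by have [d ->] := lead_cubic_subst ai; exists d.
move=> s0 i; apply/eqP; apply: contraT => ai.
have [||j [_ _]] := @lead_sum_distinct _ _ _ (index_enum 'I_3) g (index_enum_uniq _).
- apply/hasP; exists i; rewrite ?mem_index_enum // mulf_neq0 //.
  by rewrite expf_neq0 ?var_neq0.
- move=> u v _ _ /gE[d du] /gE[d' dv] e; apply/val_inj => /=.
  by have := ltn_ord u; have := ltn_ord v; rewrite e dv in du; lia.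
- by rewrite s0 eqxx.
Qed.

Lemma coordP_xT : P = X0 * T - X0 ^+ 3 * Q ^+ 2.
Proof. by rewrite /coordP /coordT; ring. Qed.

Lemma subst_PQT_factor p : p \mPo subst3 P Q T = (p \mPo cubic_subst) \mPo subst3 X0 Q T.
Proof.
rewrite comp_subst3; have [t0 t1 t2 _] := tnth_subst3 X0 Q T.
rewrite !(rmorphB, rmorphM, rmorphXn) /= !comp_mpoly_var t0 t1 t2.
by rewrite coordP_xT.
Qed.

Lemma xpowers_free (a : 'I_3 -> {mpoly k[n]}) :
  \sum_(i < 3) (a i \mPo subst3 P Q T) * X0 ^+ i = 0 ->
  forall i, a i \mPo subst3 P Q T = 0.
Proof.
move=> e i; rewrite subst_PQT_factor.
suff -> : a i \mPo cubic_subst = 0 by rewrite rmorph0.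
move: i; apply: cubic_subst_free; apply: x_Q_T_injective.
rewrite -[RHS]e raddf_sum; apply: eq_bigr => j _ /=.
rewrite rmorphM rmorphXn /= subst_PQT_factor comp_mpoly_var.
by have [-> _ _ _] := tnth_subst3 X0 Q T.
Qed.

(** * The field degree *)

Local Notation s := (subst3 P Q T).
Local Notation F := (Fmap k hn).
Local Notation L := (map_subfield F).
Local Notation fr := (@tofrac {mpoly k[n]}).

Lemma Fmap_subst3 : F = subst3 P Q R.
Proof. by []. Qed.

Hypothesis hk : 2%N \in [pchar k].

Lemma two_mpoly : 2%:R = 0 :> {mpoly k[n]}.
Proof. by rewrite -(rmorph_nat (@mpolyC n k)) (pcharf0 hk) rmorph0. Qed.

(** The two sides differ by 2 (xQ - xy) over any ring. *)
Lemma coordT_PQR : T = 1 + P * Q + P ^+ 2 * R.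
Proof.
have -> : T = 1 + P * Q + P ^+ 2 * R - 2%:R * (X0 * Q - X0 * X1).
  by rewrite /coordT /coordP /coordQ /coordR; ring.
by rewrite two_mpoly mul0r subr0.
Qed.

Lemma coordP_neq0 : P != 0.
Proof.
have e : mlead (X0 ^+ 2 * X1) = (U_(ord_x) *+ 2 + U_(ord_y))%MM.
  by rewrite mpolyXn -!mpolyXD mleadXm.
have e2 : mlead P = (U_(ord_x) *+ 2 + U_(ord_y))%MM.
  by rewrite lead_add // e ?mleadXm !(mdegD, mdegMn, mdeg1).
by apply/eqP => p0; move: (congr1 (@mdeg n) e2); rewrite p0 mlead0 mdeg0 !mdegD mdeg1.
Qed.

Lemma comp_mpolyM (t : n.-tuple {mpoly k[n]}) p q :
  (p * q) \mPo t = (p \mPo t) * (q \mPo t).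
Proof. exact: rmorphM. Qed.

(** R itself is the quotient (T - 1 - PQ) / P^2, so every element of k(F) is a
fraction of polynomials in P, Q, T and the remaining variables. *)
Lemma map_subfield_fraction u : L u ->
  exists a b, b \mPo s != 0 /\ u = fr (a \mPo s) / fr (b \mPo s).
Proof.
have [t0 t1 t2 t3] := tnth_subst3 P Q T.
have P0 := coordP_neq0.
have one p q : q = p \mPo s ->
    exists a b, b \mPo s != 0 /\ fr q = fr (a \mPo s) / fr (b \mPo s).
  by move=> ->; exists p, 1; rewrite rmorph1 oner_neq0 tofrac1 divr1.
elim=> {u} [u [[c ->]|[i ->]]||u v _ [a [b [b0 ->]]] _ [a' [b' [b0' ->]]]
           |u v _ [a [b [b0 ->]]] _ [a' [b' [b0' ->]]]].
- by apply: (one c%:MP); rewrite comp_mpolyC.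
- rewrite Fmap_subst3; have [u0 u1 u2 u3] := tnth_subst3 P Q R.
  case: (index3P i) => [->|->|->|hi].
  + by rewrite u0; apply: (one X0); rewrite comp_mpoly_var.
  + by rewrite u1; apply: (one X1); rewrite comp_mpoly_var.
  + exists (X2 - 1 - X0 * X1), (X0 ^+ 2); rewrite u2.
    rewrite !(rmorphB, rmorphXn, rmorphM, rmorph1) /= !comp_mpoly_var t0 t1 t2.
    rewrite expf_neq0 //; split=> //.
    apply: (mulIf (x := fr P ^+ 2)); first by rewrite expf_neq0 ?tofrac_eq0.
    rewrite mulfVK ?expf_neq0 ?tofrac_eq0 //.
    rewrite coordT_PQR !(tofracD, tofracXn, tofracM, tofrac1).
    by ring.
  + by rewrite u3 //; apply: (one 'X_i); rewrite comp_mpoly_var t3.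
- by rewrite -tofrac1; apply: (one 1); rewrite rmorph1.
- exists (a * b' - a' * b), (b * b').
  rewrite comp_mpolyB !comp_mpolyM mulf_neq0 // tofracB !tofracM; split=> //.
  by apply: sub_fractions; rewrite tofrac_eq0.
- have [z|a0'] := eqVneq (a' \mPo s) 0.
    exists 0, 1; rewrite rmorph1 rmorph0 oner_neq0 z tofrac0 !mul0r invr0 mulr0.
    by split.
  exists (a * b'), (b * a').
  rewrite !comp_mpolyM mulf_neq0 // !tofracM; split=> //.
  by rewrite invf_div mulf_div.
Qed.

Lemma xpowers_free_over_subfield a b c : L a -> L b -> L c ->
  a + b * fr X0 + c * fr X0 ^+ 2 = 0 -> [/\ a = 0, b = 0 & c = 0].
Proof.
move=> /map_subfield_fraction[a1 [a2 [a0 ->]]].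
move=> /map_subfield_fraction[b1 [b2 [b0 ->]]].
move=> /map_subfield_fraction[c1 [c2 [c0 ->]]] e.
pose w (i : 'I_3) := match val i with 0 => a1 * b2 * c2 | 1 => b1 * a2 * c2
  | _ => c1 * a2 * b2 end.
have h : forall i, w i \mPo s = 0.
  apply: xpowers_free; rewrite !big_ord_recl big_ord0 /w /bump /= !comp_mpolyM.
  apply/eqP; rewrite -tofrac_eq0 !(tofracD, tofracXn, tofracM, tofrac0).
  rewrite expr0 expr1 mulr1 addr0 addrA; apply/eqP.
  by apply: clear_denominators e; rewrite tofrac_eq0.
have h0 := h ord0; have h1 := h (lift ord0 ord0); have h2 := h (lift ord0 (lift ord0 ord0)).
move: h0 h1 h2; rewrite /w /= !comp_mpolyM => h0 h1 h2.
rewrite (mulf3_eq0_left b0 c0 h0) (mulf3_eq0_left a0 c0 h1).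
by rewrite (mulf3_eq0_left a0 b0 h2) tofrac0 !mul0r.
Qed.

Lemma map_subfield_degree : extension_degree L 3.
Proof.
rewrite /map_subfield; set A := (X in generated_subfield X).
have LC c : generated_subfield A (fr c%:MP) by apply: GenSubfieldBase; left; exists c.
have [u0 u1 u2 u3] := tnth_subst3 P Q R.
have LP : generated_subfield A (fr P).
  by apply: GenSubfieldBase; right; exists ord_x; rewrite Fmap_subst3 u0.
have LQ : generated_subfield A (fr Q).
  by apply: GenSubfieldBase; right; exists ord_y; rewrite Fmap_subst3 u1.
have LR : generated_subfield A (fr R).
  by apply: GenSubfieldBase; right; exists ord_z; rewrite Fmap_subst3 u2.
have LX (i : 'I_n) : (3 <= i)%N -> generated_subfield A (fr 'X_i).
  by move=> hi; apply: GenSubfieldBase; right; exists i; rewrite Fmap_subst3 u3.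
have LT : generated_subfield A (fr T).
  have -> : fr T = 1 + fr P * fr Q + fr P ^+ 2 * fr R.
    exact: etrans (congr1 fr coordT_PQR) (tofrac_PQR _ _ _).
  apply: subfieldD; first by apply: subfieldD; [apply: GenSubfieldOne | apply: subfieldM].
  by apply: subfieldM => //; rewrite expr2; apply: subfieldM.
have Q0 : fr Q != 0 by rewrite tofrac_eq0 coordQ_neq0.
have P0 : fr P != 0 by rewrite tofrac_eq0 coordP_neq0.
have x0 : fr X0 != 0 by rewrite tofrac_eq0 var_neq0.
have Lt : generated_subfield A (fr T / fr Q ^+ 2).
  by rewrite expr2; apply: subfieldM => //; apply: subfieldV; apply: subfieldM.
have Ls : generated_subfield A (- (fr P / fr Q ^+ 2)).
  rewrite expr2; apply: subfieldN; apply: subfieldM => //.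
  by apply: subfieldV; apply: subfieldM.
have xE : fr X0 ^+ 3 = fr T / fr Q ^+ 2 * fr X0 + - (fr P / fr Q ^+ 2).
  apply: (solve_cubic Q0).
  exact: etrans (congr1 fr coordP_xT) (tofrac_P _ _ _).
pose S := quadratic_span A (fr X0).
have SL u : generated_subfield A u -> S u by exact: span_L.
have SD u v : S u -> S v -> S (u + v) by exact: spanD.
have SM u v : S u -> S v -> S (u * v) by apply: spanM Ls Lt xE _ _.
have SV u : S u -> S u^-1 by apply: spanV Ls Lt xE xpowers_free_over_subfield _.
have Sx : S (fr X0) by exact: span_x.
have SN u : S u -> S (- u) by apply: spanN Ls Lt xE _.
have SX u m : S u -> S (u ^+ m) by exact: (spanX Ls Lt xE).
have S1 : S (fr X1).
  have -> : fr X1 = (fr T - 1) * (fr X0)^-1 - fr X0 * fr Q ^+ 2.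
    apply: (solve_y x0).
    exact: tofrac_T.
  apply: SD; last by apply/SN/SM => //; apply/SX/SL.
  by apply: SM; [apply: SL; apply: GenSubfieldSub => //; apply: GenSubfieldOne | exact: SV].
have S2 : S (fr X2).
  have -> : fr X2 = (fr Q - fr X1) * (fr P)^-1.
    have -> : Q = X1 + P * X2 by rewrite /coordQ /coordP; ring.
    move: P0; move: (P) => p p0.
    by rewrite tofracD tofracM addrAC subrr add0r mulrC mulKf.
  by apply: SM; [apply: SD; [exact: SL | exact: SN] | apply/SV/SL].
have SXi i : S (fr 'X_i).
  by case: (index3P i) => [->|->|->|hi] //; apply/SL/LX.
have Spoly p : S (fr p).
  rewrite (mpolyE p) rmorph_sum; apply: (big_ind S _ SD) => [|m _].
    by apply: SL; apply: subfield0.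
  rewrite -mul_mpolyC /= tofracM; apply: (SM); first exact: SL.
  rewrite mpolyXE_id rmorph_prod; apply: (big_ind S _ SM) => [|i _].
    by apply: SL; apply: GenSubfieldOne.
  by rewrite /= tofracXn; apply: SX.
apply: cubic_extension_degree xpowers_free_over_subfield _ => u.
have [a [b [_ ->]]] := frac_quotient u.
by apply: (SM _ _ (Spoly a)); apply: (SV _ (Spoly b)).
Qed.

(** * Non-injectivity *)

(** Both (1, 1, 0, 0, ...) and (0, 1, 0, 0, ...) are sent to (0, 1, 0, 0, ...). *)
Lemma not_automorphism : ~ polynomial_automorphism F.
Proof.
case=> G [_ GF].
pose v (i : 'I_n) : k := (i <= 1)%:R.
pose v' (i : 'I_n) : k := (i == ord_y)%:R.
have Fv i : (tnth F i).@[v] = (tnth F i).@[v'].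
  rewrite Fmap_subst3; have [u0 u1 u2 u3] := tnth_subst3 P Q R.
  have [v0 v1 v2] : [/\ v ord_x = 1, v ord_y = 1 & v ord_z = 0] by [].
  have [w0 w1 w2] : [/\ v' ord_x = 0, v' ord_y = 1 & v' ord_z = 0].
    by rewrite /v' eqxx.
  case: (index3P i) => [->|->|->|hi]; rewrite ?u0 ?u1 ?u2 ?u3 //;
    rewrite ?(mevalD, rmorphXn, mevalM) /= ?mevalXU ?v0 ?v1 ?v2 ?w0 ?w1 ?w2.
  - by rewrite expr1n mulr1 expr0n mul0r addr0; exact: (pcharf0 hk).
  - by ring.
  - by ring.
  - by rewrite /v /v' -val_eqE /=; case: (nat_of_ord i) hi => [|[|]].
have := congr1 (meval v') (GF ord_x); have := congr1 (meval v) (GF ord_x).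
rewrite !comp_mpoly_meval (meval_eq _ Fv) !mevalXU => -> /eqP.
by rewrite /v /v' /= oner_eq0.
Qed.

(** * The Jacobian determinant *)

Lemma mderiv_var i j : mderiv j ('X_i : {mpoly k[n]}) = (i == j)%:R.
Proof.
rewrite mderivX mnm1E; case: eqP => [->|_]; last by rewrite scale0r.
have -> : (U_(j) - U_(j))%MM = 0%MM by apply/mnmP => l; rewrite mnmBE subnn mnm0E.
by rewrite scale1r mpolyX0.
Qed.

Lemma mderiv_sqr j (p : {mpoly k[n]}) : mderiv j (p ^+ 2) = 0.
Proof.
rewrite expr2 mderivM [_ * p]mulrC -mulr2n -mulr_natl.
by rewrite two_mpoly mul0r.
Qed.

Lemma det_jacobian : \det (jacobian F) = 1.
Proof.
(* The rows of V *m U are those of U, except that z times the first row is added to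
   the second one. *)
pose U : 'M[{mpoly k[n]}]_n :=
  1%:M + X0 ^+ 2 *: delta_mx ord_x ord_y + P *: delta_mx ord_y ord_z.
pose V : 'M[{mpoly k[n]}]_n := 1%:M + X2 *: delta_mx ord_y ord_x.
have U_E i j : U i j = (i == j)%:R + X0 ^+ 2 * ((i == ord_x) && (j == ord_y))%:R
    + P * ((i == ord_y) && (j == ord_z))%:R.
  by rewrite /U; move: P (X0 ^+ 2) => p q; rewrite !mxE.
have V_E i j : V i j = (i == j)%:R + X2 * ((i == ord_y) && (j == ord_x))%:R.
  by rewrite /V; move: (X2) => q; rewrite !mxE.
have -> : jacobian F = V *m U.
  apply/matrixP => i j.
  transitivity (U i j + X2 * (delta_mx ord_y ord_x *m U) i j); last first.
    by rewrite /V mulmxDl mul1mx -scalemxAl [RHS]mxE [X in _ = _ + X]mxE.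
  have -> : (delta_mx ord_y ord_x *m U) i j = (i == ord_y)%:R * U ord_x j.
    rewrite mxE (bigD1 ord_x) //= big1 ?addr0 => [|l /negPf h].
      by rewrite !mxE eqxx andbT.
    by rewrite !mxE h andbF mul0r.
  have ji (l : 'I_n) : (j == l) = (l == j) by exact: eq_sym.
  have [n01 n10 n20 n21] : [/\ (ord_x == ord_y) = false, (ord_y == ord_x) = false,
    (ord_z == ord_x) = false & (ord_z == ord_y) = false] by [].
  rewrite Fmap_subst3; have [u0 u1 u2 u3] := tnth_subst3 P Q R.
  rewrite mxE U_E U_E !ji.
  case: (index3P i) => [->|->|->|hi]; rewrite ?u0 ?u1 ?u2 ?u3 //.
  - rewrite /coordP !(mderivD, mderiv_sqr, mderivM, mderiv_var) eqxx n01.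
    by rewrite /=; ring.
  - rewrite /coordQ !(mderivD, mderiv_sqr, mderivM, mderiv_var) !eqxx n10 n01.
    by rewrite /coordP /=; ring.
  - rewrite /coordR !(mderivD, mderiv_sqr, mderivM, mderiv_var) n20 n21.
    by rewrite /=; ring.
  - have [/negPf h0 /negPf h1] : i != ord_x /\ i != ord_y.
      by rewrite -!val_eqE /=; case: (nat_of_ord i) hi => [|[|]].
    by rewrite mderiv_var h0 h1 /=; ring.
have detV : \det V = 1.
  rewrite det_trig; last first.
    apply/is_trig_mxP => i j ij; rewrite V_E -!val_eqE /=.
    case: (nat_of_ord i) (nat_of_ord j) ij => [|[|i']] [|[|j']] //= ij;
      by rewrite ?(ltn_eqF ij) ?(mulr0n, mulr0, addr0).
  apply: big1 => i _; rewrite V_E eqxx -!val_eqE /=.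
  by case: (nat_of_ord i) => [|[|?]]; rewrite /= ?(mulr0n, mulr0, addr0).
have detU : \det U = 1.
  rewrite -det_tr det_trig; last first.
    apply/is_trig_mxP => i j ij; rewrite mxE U_E -!val_eqE /=.
    case: (nat_of_ord i) (nat_of_ord j) ij => [|[|[|i']]] [|[|[|j']]] //= ij;
      by rewrite ?(gtn_eqF ij) ?(mulr0n, mulr0, addr0).
  apply: big1 => i _; rewrite mxE U_E eqxx -!val_eqE /=.
  by case: (nat_of_ord i) => [|[|[|?]]]; rewrite /= ?(mulr0n, mulr0, addr0).
by rewrite det_mulmx; exact: etrans (congr2 *%R detV detU) (mulr1 1).
Qed.

End ThreeCoordinates.

Theorem corollary5p1 (k : fieldType) (hk : 2%N \in [pchar k])
    (n : nat) (hn : (3 <= n)%N) :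
  separable_jacobian_counterexample 2 (Fmap k hn).
Proof.
split; last exact: not_automorphism.
split=> //; first by exists 1; rewrite ?oner_neq0 // det_jacobian.
by exists 3 => //; apply: map_subfield_degree.
Qed.
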